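(* For every premeasure $\mu\in P(\mathbb T)$ and every $\eta\in\mathbb T$ we have $$\lim_{r\to1-}\tfrac12(1-r)\,\mathrm{Re}\,h_\mu(r\eta)=\mu\{\eta\}.$$
   Context: $\mathbb T$ is the unit circle, $D$ the open unit disc. An arc is a connected subset of $\mathbb T$. A premeasure on $\mathbb T$ is a function $\mu$ from the set of arcs to $\mathbb R$ such that $\mu(\emptyset)=\mu(\mathbb T)=0$; $\mu(C_1\cup C_2)=\mu(C_1)+\mu(C_2)$ for disjoint arcs $C_1,C_2$ whose union is an arc; and $\lim_\nu\mu(C_\nu)=0$ for every sequence of arcs $C_1\supset C_2\supset\cdots$ with $\bigcap_\nu C_\nu=\emptyset$. $P(\mathbb T)$ is the space of premeasures. The cumulative mass function of $\mu$ is $\hat\mu(\theta)=\mu(\{e^{it}:0\le t<\theta\})$ for $0\le\theta<2\pi$; it is bounded with left and right limits everywhere. The Herglotz transform of $\mu$ is the analytic function on $D$ $$h_\mu(z)=2iz\int_0^{2\pi}\frac{e^{i\theta}}{(e^{i\theta}-z)^2}\,\hat\mu(\theta)\,d\theta .$$ *)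

(* Defs.v *)
From HB Require Import structures.
From mathcomp Require Import all_boot all_order all_algebra.
From mathcomp Require Import all_classical all_reals all_analysis.
From mathcomp Require Import complex.

Set Implicit Arguments.
Unset Strict Implicit.
Unset Printing Implicit Defensive.

Import Order.TTheory GRing.Theory Num.Theory.
Import numFieldNormedType.Exports.

Local Open Scope classical_set_scope.
Local Open Scope complex_scope.
Local Open Scope ring_scope.

Section Premeasures.
Variable R : realType.
Implicit Types (C : set R[i]) (mu : set R[i] -> R) (z : R[i]) (t theta : R).

Definition circle : set R[i] := [set z | `|z| = 1].

(* [R[i]^o] carries the metric topology of the complex modulus. The empty set
   and the whole circle count as connected, hence as arcs. *)
Definition is_arc C := C `<=` circle /\ connected (C : set R[i]^o).

(* A premeasure is a function on arcs; it is encoded as a function on all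
   subsets of the plane whose values outside the arcs are irrelevant. *)
Record is_premeasure mu : Prop := IsPremeasure {
  premeasure0 : mu set0 = 0 ;
  premeasure_circle : mu circle = 0 ;
  premeasureU : forall C1 C2, is_arc C1 -> is_arc C2 -> is_arc (C1 `|` C2) ->
    C1 `&` C2 = set0 -> mu (C1 `|` C2) = mu C1 + mu C2 ;
  premeasure_cvg0 : forall C_ : nat -> set R[i], (forall n, is_arc (C_ n)) ->
    (forall n, C_ n.+1 `<=` C_ n) -> \bigcap_n C_ n = set0 ->
    mu (C_ n) @[n --> \oo] --> 0 }.

Definition expi t : R[i] := cos t +i* sin t.

Definition cumulative_mass mu theta : R := mu (expi @` `[0, theta[).

Definition Cintegral (D : set R) (f : R -> R[i]) : R[i] :=
  (\int[lebesgue_measure]_(t in D) complex.Re (f t)) +i*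
  (\int[lebesgue_measure]_(t in D) complex.Im (f t)).

Definition herglotz mu z : R[i] :=
  2 * 'i%C * z * Cintegral `[0, 2 * pi[ (fun theta =>
    expi theta / (expi theta - z) ^+ 2 * (cumulative_mass mu theta)%:C).

End Premeasures.

Arguments circle {R}.

(* Main.v *)
(** The real part of the Herglotz kernel is minus the derivative of the Poisson
    kernel [P_r], so for [eta = expi phi],
    [Re h (r eta) = - \int_0^(2 pi) F(t) P_r'(t - phi) dt], where [F] is the
    cumulative mass function. The kernel [k_r = - (1 - r) / 2 * P_r'] is odd,
    tends uniformly to [0] away from [2 pi Z] and has integral tending to [1]
    over [`[0, c]], [0 < c < 2 pi]. Hence [\int F(t) k_r(t - phi) dt] tends to
    the jump of [F] at [phi], which is [mu {eta}]; when [phi = 0] the left limit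
    is taken at [2 pi], where [F] vanishes because [mu circle = 0]. *)

Require Import Defs.
From mathcomp Require Import all_boot all_order all_algebra.
From mathcomp Require Import all_classical all_reals all_analysis.
From mathcomp Require Import measurable_realfun complex ring lra.
Import Order.TTheory GRing.Theory Num.Theory.
Import numFieldNormedType.Exports.
Local Open Scope classical_set_scope.
Local Open Scope complex_scope.
Local Open Scope ring_scope.

(** * One-sided limits tested on monotone sequences *)

Section MonotoneLimits.
Variable R : realType.
Implicit Types (f : R -> R) (u : R^nat).

(** The continuity axiom of a premeasure concerns only nested sequences of arcs, so one-sided limits
    must be reduced to monotone sequences. If the limit fails, points with [e <= |l - f|] exist
    arbitrarily close to [p], and dependent choice arranges them into a nondecreasing sequence. *)
Lemma cvg_at_left_nondecreasing f (a p l : R) : a < p ->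
  (forall u, (forall n, a < u n < p) -> nondecreasing_seq u ->
    u n @[n --> \oo] --> p -> f (u n) @[n --> \oo] --> l) ->
  f x @[x --> p^'-] --> l.
Proof.
move=> ap fu; apply: contrapT => /cvgrPdist_lt/existsNP[e /not_implyP[e0 nfe]].
(* Each new point lies at least halfway from the previous one to [p], which forces geometric
   convergence to [p]. *)
have far (x : {x : R | a < x < p}) : {y : {x : R | a < x < p} |
    [/\ sval x <= sval y, (sval x + p) / 2 <= sval y & e <= `|l - f (sval y)|]}.
  apply: cid; case: x => x /= /andP[ax xp].
  apply: contrapT => H; apply: nfe; near=> y; rewrite ltNge; apply/negP => fey.
  have xpy : (x + p) / 2 < y by near: y; apply: nbhs_left_gt; lra.
  have yp : y < p by near: y; exact: nbhs_left_lt.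
  have ayp : a < y < p by apply/andP; split; lra.
  by apply: H; exists (exist (fun x => is_true (a < x < p)) y ayp) => /=; split => //; lra.
have amp : a < (a + p) / 2 < p by apply/andP; split; lra.
have [v [_ vS]] := dependent_choice far (exist (fun x => is_true (a < x < p)) _ amp).
(* The shift drops the starting midpoint, where [f] is not known to be far from [l]. *)
pose u n := sval (v n.+1).
have up n : a < u n < p by rewrite /u; case: (v n.+1).
have fuE n : e <= `|l - f (u n)| by have [] := vS n.
have und : nondecreasing_seq u by apply/nondecreasing_seqP => n; have [] := vS n.+1.
have uS n : (u n + p) / 2 <= u n.+1 by have [] := vS n.+1.
have ucvg : u n @[n --> \oo] --> p.
  have bnd n : p - u n <= (p - a) * 2^-1 ^+ n.
    elim: n => [|n IH]; first by rewrite expr0 mulr1; have /andP[] := up 0%N; lra.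
    by rewrite exprSr mulrA; move: (uS n) IH; lra.
  apply: (@squeeze_cvgr _ _ _ _ (fun n => p - (p - a) * 2^-1 ^+ n) (fun=> p)).
  - by near=> n; have /andP[_ /ltW ->] := up n; have := bnd n; rewrite andbT; lra.
  - rewrite -[X in _ --> X]subr0 -(mulr0 (p - a)).
    apply: cvgB; first exact: cvg_cst.
    by apply: cvgMr; apply: cvg_expr; rewrite ger0_norm; lra.
  - exact: cvg_cst.
have /cvgrPdist_lt/(_ e e0)[N _ /(_ N (leqnn N))] := fu u up und ucvg.
by rewrite /= ltNge fuE.
Unshelve. all: by end_near. Qed.

Lemma cvg_at_right_nonincreasing f (p b l : R) : p < b ->
  (forall u, (forall n, p < u n < b) -> nonincreasing_seq u ->
    u n @[n --> \oo] --> p -> f (u n) @[n --> \oo] --> l) ->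
  f x @[x --> p^'+] --> l.
Proof.
move=> pb fu; apply/cvg_at_rightNP.
apply: (@cvg_at_left_nondecreasing _ (- b)); first lra.
move=> u ub und /cvgN; rewrite opprK => cu.
apply: (fu (fun n => - u n)) => // [n|m n mn].
  by have /andP[? ?] := ub n; apply/andP; split; lra.
by rewrite lerN2 und.
Qed.

End MonotoneLimits.

(** * Angular parametrization of the circle *)

Section Circle.
Variable R : realType.
Implicit Types (z : R[i]) (t : R).

Lemma norm_expi t : `|expi t| = 1.
Proof. by rewrite normc_def /= cos2Dsin2 sqrtr1. Qed.

Lemma continuous_expi : continuous (@expi R : R -> R[i]^o).
Proof.
(* Positivity in [R[i]] means zero imaginary part and positive real part, so the tolerance is in
   effect the real number [complex.Re e]. *)
move=> t; apply/cvgrPdist_lt => e; rewrite ltcE /= => /andP[/eqP Ime0 Ree0].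
near=> s; have hc : `|cos t - cos s| < complex.Re e / 2.
  near: s; have /cvgrPdist_lt := @continuous_cos R t.
  by apply; rewrite divr_gt0.
have hd : `|sin t - sin s| < complex.Re e / 2.
  near: s; have /cvgrPdist_lt := @continuous_sin R t.
  by apply; rewrite divr_gt0.
rewrite normc_def ltcE /= Ime0 eqxx /=.
move: hc hd; set c := cos t + _; set d := sin t + _ => hc hd.
apply: (@le_lt_trans _ _ (`|c| + `|d|)); last lra.
rewrite -[leRHS]ger0_norm ?addr_ge0// -[leRHS]sqrtr_sqr ler_wsqrtr//.
by rewrite [leRHS]sqrrD !real_normK ?num_real// lerD2r lerDl mulrn_wge0// mulr_ge0.
Unshelve. all: by end_near. Qed.

Lemma is_arc_expi (I : set R) : is_interval I -> is_arc (@expi R @` I).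
Proof.
move=> itvI; split; first by move=> _ [t _ <-]; exact: norm_expi.
apply: connected_continuous_connected; first exact/connected_intervalP.
by apply: continuous_subspaceT; exact: continuous_expi.
Qed.

(** Half-angle formula: [cos t = 1 - 2 sin^2(t / 2)], with [t / 2] strictly between [0] and [pi]. *)
Lemma cos_lt1 t : 0 < t < 2 * pi -> cos t < 1.
Proof.
move=> /andP[t0 t2pi].
have := @sin_gt0_pi R (t / 2); rewrite divr_gt0//= => /(_ ltac:(lra)) s0.
have -> : t = (t / 2) *+ 2 by rewrite mulr2n; lra.
by rewrite cos_mulr2n cos2sin2 mulr2n; have := exprn_gt0 2 s0; lra.
Qed.

(** If [expi s = expi t], the subtraction formula gives [cos (t - s) = 1], which [cos_lt1] forbids
    when [0 < t - s < 2 * pi]. *)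
Lemma expi_inj : {in `[0, 2 * pi[ &, injective (@expi R)}.
Proof.
move=> s t; rewrite !in_itv /=.
wlog st : s t / s <= t => [wl|] hs ht [] ec es.
  by have [/wl|/ltW/wl] := leP s t; [apply => //; rewrite /expi ec es|
    move=> h; apply/esym/h => //; rewrite /expi ec es].
apply/eqP; rewrite eq_le st /= leNgt; apply/negP => lt_st.
have : cos (t - s) < 1 by apply: cos_lt1; lra.
by rewrite cosB ec es -!expr2 cos2Dsin2 ltxx.
Qed.

Lemma circle_expi z : circle z -> exists2 t, 0 <= t < 2 * pi & expi t = z.
Proof.
case: z => x y; rewrite /circle /= normc_def /= => -[] xy1.
have {}xy1 : x ^+ 2 + y ^+ 2 = 1.
  by rewrite -[LHS]sqr_sqrtr ?addr_ge0 ?sqr_ge0// xy1 expr1n.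
have x1 : -1 <= x <= 1 by apply/andP; split; nra.
have c : cos (acos x) = x by apply: acosK; rewrite in_itv.
have a0 : 0 <= acos x by exact: acos_ge0.
have api : acos x <= pi by exact: acos_lepi.
have pi0 := pi_gt0 R.
have s : sin (acos x) = `|y|.
  by rewrite sin_acos// -sqrtr_sqr; congr Num.sqrt; lra.
have [y0|y0] := leP 0 y.
  exists (acos x); first by apply/andP; split; lra.
  by rewrite /expi c s ger0_norm.
exists (2 * pi - acos x).
  (* The angle must stay strictly below [2 * pi]; [acos x = 0] would give [|y| = sin 0 = 0]. *)
  suff : acos x != 0.
    move=> an0; have : 0 < acos x by rewrite lt_neqAle eq_sym an0.
    by move=> ?; apply/andP; split; lra.
  by apply: contra_eqN s => /eqP ->; rewrite sin0 ltr0_norm//; apply/eqP; lra.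
have -> : 2 * pi - acos x = - acos x + pi *+ 2 by rewrite mulr2n; lra.
by rewrite /expi cosD2pi sinD2pi cosN sinN c s ltr0_norm// opprK.
Qed.

End Circle.

(** * One-sided limits of the cumulative mass function *)

Section CumulativeMass.
Variables (R : realType) (mu : set R[i] -> R).
Hypothesis mu_premeasure : is_premeasure mu.
Implicit Types (I J : set R) (s t p : R).

(** On [[0, 2 pi[] the map [expi] is injective, so disjoint intervals of angles give disjoint arcs
    and additivity transfers to intervals. *)
Lemma premeasure_expiU I J : I `|` J `<=` `[0, 2 * pi[ ->
  is_interval I -> is_interval J -> is_interval (I `|` J) ->
  I `&` J = set0 -> mu (@expi R @` (I `|` J)) = mu (@expi R @` I) + mu (@expi R @` J).
Proof.
move=> IJ itvI itvJ itvIJ disj; rewrite image_setU.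
apply: premeasureU => //; rewrite -?image_setU; try exact: is_arc_expi.
rewrite -subset0 => z [[s Is <-] [t Jt ts]].
have e : t = s by apply: expi_inj => //; apply: IJ; [right|left].
suff : (I `&` J) s by rewrite disj.
by split => //; rewrite -e.
Qed.

(** By injectivity of [expi], a point common to all the arcs has a single angle, which would lie in
    every [I_ n]. *)
Lemma premeasure_expi_cvg0 (I_ : nat -> set R) :
  (forall n, I_ n `<=` `[0, 2 * pi[) -> (forall n, is_interval (I_ n)) ->
  (forall n, I_ n.+1 `<=` I_ n) -> \bigcap_n I_ n = set0 ->
  mu (@expi R @` I_ n) @[n --> \oo] --> 0.
Proof.
move=> I2pi itvI decI capI; apply: (premeasure_cvg0 mu_premeasure).
- by move=> n; exact: is_arc_expi.
- by move=> n; exact: image_subset.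
- rewrite -subset0 => z zI; have [s Is sz] := zI 0%N Logic.I.
  have : (\bigcap_n I_ n) s; last by rewrite capI.
  move=> n _; have [t It tz] := zI n Logic.I.
  suff -> : s = t by [].
  by apply: expi_inj; rewrite ?tz//; [exact: I2pi Is|exact: I2pi It].
Qed.

Lemma cumulative_mass_le0 t : t <= 0 -> cumulative_mass mu t = 0.
Proof.
by move=> t0; rewrite /cumulative_mass set_itv_ge ?bnd_simp -?leNgt// image_set0 premeasure0.
Qed.

Lemma cumulative_mass_2pi : cumulative_mass mu (2 * pi) = 0.
Proof.
rewrite -[RHS](premeasure_circle mu_premeasure); congr mu.
apply/seteqP; split => [_ [t _ <-]|z /circle_expi[t tb <-]].
  exact: norm_expi.
by exists t => //=; rewrite in_itv.
Qed.

(** The difference of the values at [p] and [t] is the mass of the arc over [[t, p[], and these arcs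
    decrease to the empty set as [t] increases to [p]. *)
Lemma cumulative_mass_cvg_left p : 0 < p <= 2 * pi ->
  cumulative_mass mu t @[t --> p^'-] --> cumulative_mass mu p.
Proof.
move=> /andP[p0 p2pi].
have : cumulative_mass mu p - mu (@expi R @` `[t, p[) @[t --> p^'-] -->
    cumulative_mass mu p - 0.
  apply: cvgB; first exact: cvg_cst.
  apply: (@cvg_at_left_nondecreasing _ _ 0) => // u ub und ucvg.
  apply: (@premeasure_expi_cvg0 (fun n => `[u n, p[%classic)) => [n|n|n|].
  - have /andP[? ?] := ub n; move=> x /=; rewrite !in_itv /= => /andP[? ?].
    by apply/andP; split; lra.
  - exact: interval_is_interval.
  - move=> x /=; rewrite !in_itv /= => /andP[? ->]; rewrite andbT.
    by apply: le_trans (und _ _ (leqnSn n)) _.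
  - rewrite -subset0 => x /= xI.
    have xp : x < p by have := xI 0%N Logic.I; rewrite /= in_itv /= => /andP[].
    have /cvgrPdist_lt/(_ (p - x)) := ucvg; rewrite subr_gt0 xp => /(_ isT)[n _].
    move=> /(_ n (leqnn n)) /=; have := xI n Logic.I.
    by rewrite /= in_itv /= => /andP[? ?]; rewrite ger0_norm; lra.
rewrite subr0; apply: cvg_trans; apply: near_eq_cvg; near=> t.
have t0 : 0 < t by near: t; exact: nbhs_left_gt.
have tp : t < p by near: t; exact: nbhs_left_lt.
rewrite /cumulative_mass.
have E : `[0, p[%classic = `[0, t[ `|` `[t, p[.
  by apply: itv_bndbnd_setU; rewrite bnd_simp ltW.
rewrite E premeasure_expiU ?addrK//; try exact: interval_is_interval.
- by move=> x [] /=; rewrite !in_itv /= => /andP[? ?]; apply/andP; split; lra.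
- by rewrite -E; exact: interval_is_interval.
- rewrite -subset0 => x [] /=; rewrite !in_itv /= => /andP[? ?] /andP[? ?]; lra.
Unshelve. all: by end_near. Qed.

(** For [t > p] the interval [[0, t[] splits into [[0, p[], the point [p], and []p, t[]. Only the
    last piece shrinks to the empty set, so the mass of the point survives as the jump. *)
Lemma cumulative_mass_cvg_right p : 0 <= p < 2 * pi ->
  cumulative_mass mu t @[t --> p^'+] -->
    cumulative_mass mu p + mu [set expi p].
Proof.
move=> /andP[p0 p2pi].
have : cumulative_mass mu p + mu [set expi p] + mu (@expi R @` `]p, t[)
    @[t --> p^'+] --> cumulative_mass mu p + mu [set expi p] + 0.
  apply: cvgD; first exact: cvg_cst.
  apply: (@cvg_at_right_nonincreasing _ _ _ (2 * pi)) => // u ub und ucvg.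
  apply: (@premeasure_expi_cvg0 (fun n => `]p, u n[%classic)) => [n|n|n|].
  - have /andP[? ?] := ub n; move=> x /=; rewrite !in_itv /= => /andP[? ?].
    by apply/andP; split; lra.
  - exact: interval_is_interval.
  - move=> x /=; rewrite !in_itv /= => /andP[-> ?] /=.
    by apply: lt_le_trans (und _ _ (leqnSn n)).
  - rewrite -subset0 => x /= xI.
    have xp : p < x by have := xI 0%N Logic.I; rewrite /= in_itv /= => /andP[].
    have /cvgrPdist_lt/(_ (x - p)) := ucvg; rewrite subr_gt0 xp => /(_ isT)[n _].
    move=> /(_ n (leqnn n)) /=; have := xI n Logic.I.
    by rewrite /= in_itv /= => /andP[? ?]; rewrite distrC ger0_norm; lra.
rewrite addr0; apply: cvg_trans; apply: near_eq_cvg; near=> t.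
have t0 : p < t by near: t; exact: nbhs_right_gt.
have tp : t < 2 * pi by near: t; exact: nbhs_right_lt.
rewrite /cumulative_mass.
have E1 : `[0, p]%classic = `[0, p[ `|` [set p].
  by rewrite setUitv1// bnd_simp.
have E2 : `[0, t[%classic = `[0, p] `|` `]p, t[.
  by apply: itv_bndbnd_setU; rewrite bnd_simp// ltW.
have itv1 : is_interval [set p] by rewrite -set_itv1; exact: interval_is_interval.
rewrite E2 premeasure_expiU; last first.
- rewrite -subset0 => x [] /=; rewrite !in_itv /= => /andP[? ?] /andP[? ?]; lra.
- by rewrite -E2; exact: interval_is_interval.
- exact: interval_is_interval.
- exact: interval_is_interval.
- by rewrite -E2 => x /=; rewrite !in_itv /= => /andP[? ?]; apply/andP; split; lra.
rewrite E1 premeasure_expiU ?image_set1//.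
- by rewrite -E1 => x /=; rewrite !in_itv /= => /andP[? ?]; apply/andP; split; lra.
- exact: interval_is_interval.
- by rewrite -E1; exact: interval_is_interval.
- by rewrite -subset0 => x [] /=; rewrite in_itv /= => /andP[_ xp] xE; rewrite xE ltxx in xp.
Unshelve. all: by end_near. Qed.

End CumulativeMass.

(** * Measurability and boundedness from one-sided limits *)

Section Regulated.
Variable R : realType.
Implicit Types (f : R -> R) (D : set R).

(** The function is a pointwise limit of step functions [f \o g n], each constant on the cells of a
    countable grid. *)
Lemma left_continuous_measurable_fun D f :
  (forall t, D t -> f x @[x --> t^'-] --> f t) -> measurable_fun D f.
Proof.
move=> fl.
(* [g n t] is the largest multiple of [1/(n+1)] strictly below [t]. *)
pose g (n : nat) (t : R) : R := (Num.ceil (n.+1%:R * t) - 1)%:~R / n.+1%:R.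
have g_bound (n : nat) (t : R) : t - n.+1%:R^-1 <= g n t < t.
  have n0 : 0 < n.+1%:R :> R by rewrite ltr0n.
  rewrite /g ler_pdivlMr// ltr_pdivrMr// mulrBl mulVf ?gt_eqF//.
  have /andP[] := ceil_itv (n.+1%:R * t).
  by rewrite rmorphB /= [t * _]mulrC => -> ?; rewrite andbT lerB.
apply: (measurable_fun_cvg (h := fun n => f \o g n)) => [n|t Dt].
  apply: measurable_funTS => _ /= Y mY; rewrite setTI.
  have -> : (f \o g n) @^-1` Y = \bigcup_(k : int)
      ([set t : R | Num.ceil (n.+1%:R * t) = k] `&`
       [set _ | Y (f ((k - 1)%:~R / n.+1%:R))]).
    apply/seteqP; split => [t /= Yt|t [k _ [/= <-]]] //.
    by exists (Num.ceil (n.+1%:R * t)).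
  apply: countable_bigcupT_measurable => [|k]; first exact: countableP.
  have [Yk|nYk] := pselect (Y (f ((k - 1)%:~R / n.+1%:R))); last first.
    rewrite (_ : _ `&` _ = set0)//; first by apply/seteqP; split => // t [].
  rewrite (_ : _ `&` _ = `](k - 1)%:~R / n.+1%:R, k%:~R / n.+1%:R]%classic)//.
  apply/seteqP; split => t /=; rewrite in_itv /= ltr_pdivrMr ?ltr0n//
    ler_pdivlMr ?ltr0n// mulrC -ceil_eq.
    by move=> [/eqP].
  by move=> /eqP.
(* The sequential criterion asks for points strictly below [t]; a floor in place of [ceil - 1] would
   return [t] itself at grid points. *)
have /cvg_at_leftP := fl _ Dt; apply; split => [n|].
  by have /andP[] := g_bound n t.
apply: (@squeeze_cvgr _ _ _ _ (fun n => t - n.+1%:R^-1) (fun=> t)).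
- by near=> n; have /andP[-> /ltW ->] := g_bound n t.
- rewrite -[X in _ --> X]subr0; apply: cvgB; first exact: cvg_cst.
  exact: cvg_harmonic.
- exact: cvg_cst.
Unshelve. all: by end_near. Qed.

(** Near each point, [f] is bounded by its value there and by its one-sided limits plus one;
    compactness, in its near-covering form, turns these local bounds into one. *)
Lemma bounded_on_segment f (a b : R) :
  (forall p, a < p <= b -> cvg (f x @[x --> p^'-])) ->
  (forall p, a <= p < b -> cvg (f x @[x --> p^'+])) ->
  exists M, forall x, a <= x <= b -> `|f x| <= M.
Proof.
move=> fl fr.
have bound_near (l y : R) : `|l - y| < 1 -> `|y| <= `|l| + 1.
  by move=> /ltW ly; rewrite -[y](subKr l) (le_trans (ler_normB _ _))// lerD.
have /compact_near_coveringP/near_covering_withinP cov := @segment_compact R a b.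
have : \forall M \near +oo, `[a, b] `<=` (fun x => `|f x| <= M).
  apply: cov => p; rewrite /= in_itv /= => /andP[pa pb].
  have [B1 HB1] : exists B1, \forall x \near p, a <= x -> x < p -> `|f x| <= B1.
    have [pa'|ap] := leP p a.
      (* No point of the segment lies to the left of its left end, so the bound is a dummy. *)
      exists 0; near=> x => ax xp.
      by have := le_lt_trans ax (lt_le_trans xp pa'); rewrite ltxx.
    have /fl/cvgrPdist_lt/(_ 1 ltr01) fp : a < p <= b by rewrite ap.
    exists (`|lim (f x @[x --> p^'-])| + 1); near=> x => _ xp.
    by apply: bound_near; move: xp; near: x; exact: fp.
  have [B2 HB2] : exists B2, \forall x \near p, x <= b -> p < x -> `|f x| <= B2.
    have [pb'|bp] := leP b p.
      exists 0; near=> x => xb px.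
      by have := le_lt_trans pb' (lt_le_trans px xb); rewrite ltxx.
    have /fr/cvgrPdist_lt/(_ 1 ltr01) fp : a <= p < b by rewrite pa.
    exists (`|lim (f x @[x --> p^'+])| + 1); near=> x => _ xp.
    by apply: bound_near; move: xp; near: x; exact: fp.
  pose B := Num.max `|f p| (Num.max B1 B2).
  exists ([set x | a <= x <= b -> `|f x| <= B], [set M | B <= M]) => /=.
    split; last by apply: nbhs_pinfty_ge; exact: num_real.
    near=> x => /andP[ax xb]; rewrite /B !le_max.
    have [xp|px|->] := ltgtP x p; last by rewrite lexx.
      apply/orP; right; apply/orP; left; move: ax xp; near: x; exact: HB1.
    by apply/orP; right; apply/orP; right; move: xb px; near: x; exact: HB2.
  by move=> [x M] /= [xB BM]; rewrite in_itv => /xB /le_trans; apply.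
by move=> /filter_ex[M fM]; exists M => x xab; apply: fM; rewrite /= in_itv.
Unshelve. all: by end_near. Qed.

End Regulated.

(** * The jump kernel, its primitive and its decay *)

Section JumpKernel.
Set Implicit Arguments.
Unset Strict Implicit.
Variable R : realType.
Implicit Types (r s e c t : R).

(** The squared modulus of [1 - r e^(is)], which is the denominator of the Poisson kernel. *)
Definition poisson_denom r s := 1 - 2 * r * cos s + r ^+ 2.

(* [(1 - r) / 2] times minus the derivative of the Poisson kernel. *)
Definition jump_kernel r s :=
  r * (1 - r) * (1 - r ^+ 2) * sin s / poisson_denom r s ^+ 2.

(** This is [- (1 - r) / 2] times the Poisson kernel. *)
Definition jump_primitive r s :=
  - ((1 - r) * (1 - r ^+ 2) / 2) / poisson_denom r s.

Lemma poisson_denomE r s :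
  poisson_denom r s = (1 - r) ^+ 2 + 2 * r * (1 - cos s).
Proof. by rewrite /poisson_denom; ring. Qed.

Lemma poisson_denom_gt0 r s : 0 < r < 1 -> 0 < poisson_denom r s.
Proof.
move=> /andP[r0 r1]; rewrite poisson_denomE ltr_pwDl//.
  by rewrite exprn_gt0// subr_gt0.
by rewrite !mulr_ge0// ?subr_ge0 ?cos_le1// ltW.
Qed.

Lemma continuous_poisson_denom r : continuous (poisson_denom r).
Proof.
move=> s; apply: cvgD; last exact: cvg_cst.
apply: cvgB; first exact: cvg_cst.
by apply: cvgM; [exact: cvg_cst|exact: continuous_cos].
Qed.

Lemma continuous_jump_kernel r : 0 < r < 1 -> continuous (jump_kernel r).
Proof.
move=> r01 s; apply: cvgM.
  by apply: cvgM; [exact: cvg_cst|exact: continuous_sin].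
apply: cvgV; first by rewrite expf_neq0// gt_eqF// poisson_denom_gt0.
by apply: cvgM; exact: continuous_poisson_denom.
Qed.

Lemma continuous_jump_kernel_affine r e p : 0 < r < 1 ->
  continuous (fun t => jump_kernel r (e * (t - p))).
Proof.
move=> r01 t; apply: (@continuous_comp _ _ _ (fun t => e * (t - p))).
  by apply: cvgM; [exact: cvg_cst|apply: cvgB; [exact: cvg_id|exact: cvg_cst]].
exact: continuous_jump_kernel.
Qed.

(** The condition on [e] makes it a sign, so both sides of [p] are treated at once; the chain rule
    produces a second factor [e] that cancels the first. *)
Lemma is_derive_jump_primitive r e p t : 0 < r < 1 -> e * e = 1 ->
  is_derive t 1 (fun x => e * jump_primitive r (e * (x - p)))
    (jump_kernel r (e * (t - p))).
Proof.
move=> r01 ee1.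
have d0 := gt_eqF (poisson_denom_gt0 (e * (t - p)) r01).
have dd : is_derive t 1 (fun x => poisson_denom r (e * (x - p)))
    (e * (2 * r * sin (e * (t - p)))).
  rewrite /poisson_denom.
  by apply: is_derive_eq; rewrite /GRing.scale /=; ring.
have di : is_derive t 1 (fun x => (poisson_denom r (e * (x - p)))^-1)
    (- (poisson_denom r (e * (t - p))) ^- 2 *: (e * (2 * r * sin (e * (t - p))))).
  by apply: is_deriveV; rewrite d0.
apply: is_derive_eq.
rewrite /jump_kernel /GRing.scale /=.
set D := poisson_denom _ _ in d0 *; set S := sin _.
transitivity (e * e * (r * (1 - r) * (1 - r ^+ 2) * S / D ^+ 2)).
  by field; rewrite d0.
by rewrite ee1 mul1r.
Qed.

Lemma integral_jump_kernel r e p a b : 0 < r < 1 -> e * e = 1 -> a < b ->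
  \int[lebesgue_measure]_(t in `[a, b[) jump_kernel r (e * (t - p)) =
  e * jump_primitive r (e * (b - p)) - e * jump_primitive r (e * (a - p)).
Proof.
move=> r01 ee1 ab.
have cK := @continuous_jump_kernel_affine r e p r01.
have dF t := is_derive_jump_primitive p t r01 ee1.
have cF : continuous (fun t => e * jump_primitive r (e * (t - p))).
  by move=> t; apply: differentiable_continuous; apply/derivable1_diffP; case: (dF t).
have iK : lebesgue_measure.-integrable `[a, b]
    (EFin \o fun t => jump_kernel r (e * (t - p))).
  by apply: continuous_compact_integrable;
    [exact: segment_compact|exact: continuous_subspaceT].
rewrite Rintegral_itv_bndo_bndc; last first.
  by apply: integrableS iK => //; apply: subset_itvl; rewrite bnd_simp.
rewrite /Rintegral (continuous_FTC2 (F := fun t => e * jump_primitive r (e * (t - p))))//.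
- exact: continuous_subspaceT.
- split.
  + by move=> t _; case: (dF t).
  + by apply: cvg_at_right_filter; exact: cF.
  + by apply: cvg_at_left_filter; exact: cF.
- by move=> t _; rewrite derive1E; case: (dF t).
Qed.

(** At angle [0] the denominator is [(1 - r)^2], and the quotient simplifies to [- (1 + r) / 2]. *)
Lemma jump_primitive0_cvg : jump_primitive r 0 @[r --> (1 : R)^'-] --> (-1 : R).
Proof.
have : - (1 + r) / 2 @[r --> (1 : R)^'-] --> (- (1 + 1) / 2 : R).
  apply: cvg_at_left_filter; apply: cvgM; last exact: cvg_cst.
  by apply: cvgN; apply: cvgD; [exact: cvg_cst|exact: cvg_id].
rewrite mulNr divff ?pnatr_eq0//; apply: cvg_trans; apply: near_eq_cvg; near=> r.
have r1 : r < 1 by near: r; exact: nbhs_left_lt.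
rewrite /jump_primitive poisson_denomE cos0; field; lra.
Unshelve. all: by end_near. Qed.

(** The numerator tends to [0] while the denominator tends to [2 (1 - cos c) > 0]; the limit [0] is
    rewritten as the value of the formula at [r = 1]. *)
Lemma jump_primitive_cvg0 c : cos c < 1 ->
  jump_primitive r c @[r --> (1 : R)^'-] --> (0 : R).
Proof.
move=> c1.
have -> : 0 = - ((1 - 1) * (1 - 1 * 1) / 2) / (1 - 2 * 1 * cos c + 1 * 1) :> R.
  by ring.
apply: cvg_at_left_filter; apply: cvgM.
  apply: cvgN; apply: cvgM; last exact: cvg_cst.
  apply: cvgM; apply: cvgB; try exact: cvg_cst; first exact: cvg_id.
  by apply: cvgM; exact: cvg_id.
apply: cvgV; first by apply/eqP; lra.
apply: cvgD; last by apply: cvgM; exact: cvg_id.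
apply: cvgB; first exact: cvg_cst.
by apply: cvgM; [apply: cvgM; [exact: cvg_cst|exact: cvg_id]|exact: cvg_cst].
Qed.

(** On [[d, c]] the cosine has a maximum [cos m < 1]. For [r > 1/2] the denominator is then at least
    [1 - cos m], whereas the numerator is at most [1 - r] in absolute value. *)
Lemma jump_kernel_far (d c e : R) : 0 < d -> c < 2 * pi -> 0 < e ->
  \forall r \near (1 : R)^'-, forall s, d <= s <= c -> `|jump_kernel r s| <= e.
Proof.
move=> d0 c2pi e0.
have [cd|dc] := ltP c d; first by near=> r => s; lra.
have [m mdc mP] := @EVT_max R cos d c dc (continuous_subspaceT (@continuous_cos R)).
have m1 : cos m < 1.
  by apply: cos_lt1; move: mdc; rewrite in_itv /= => /andP[? ?]; apply/andP; split; lra.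
have m10 : 0 < 1 - cos m by rewrite subr_gt0.
near=> r => s sdc.
have r1 : r < 1 by near: r; exact: nbhs_left_lt.
have r2 : 2^-1 < r by near: r; apply: nbhs_left_gt; lra.
(* This threshold makes [1 - r] smaller than [e] times the lower bound of the squared
   denominator. *)
have re : 1 - e * (1 - cos m) ^+ 2 < r.
  by near: r; apply: nbhs_left_gt; rewrite ltrBlDr ltrDl mulr_gt0// exprn_gt0.
have D0 : 1 - cos m <= poisson_denom r s.
  have := mP s; rewrite in_itv /= => /(_ sdc) sm.
  rewrite poisson_denomE; nra.
have D00 : 0 < poisson_denom r s by exact: lt_le_trans D0.
rewrite /jump_kernel normrM normfV [X in _ / X]ger0_norm; last first.
  by rewrite exprn_ge0// ltW.
rewrite ler_pdivrMr ?exprn_gt0// normrM.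
have sl : `|sin s| <= 1 by exact: sin_max.
have A0 : 0 <= r * (1 - r) * (1 - r ^+ 2) by rewrite !mulr_ge0//; nra.
rewrite [`|_ * _ * _|]ger0_norm//.
apply: (@le_trans _ _ (1 - r)).
  rewrite -[leRHS]mulr1; apply: ler_pM => //.
  by rewrite -[leRHS]mul1r [r * _]mulrC -mulrA -[leRHS]mulrC ler_wpM2l//; nra.
apply: (@le_trans _ _ (e * (1 - cos m) ^+ 2)); first lra.
apply: ler_wpM2l; first exact: ltW.
by rewrite lerXn2r// nnegrE ltW.
Unshelve. all: by end_near. Qed.

Lemma integrable_bounded_mul_continuous (f h : R -> R) (a b M : R) :
  measurable_fun `[a, b[ f -> (forall t, a <= t < b -> `|f t| <= M) ->
  continuous h ->
  lebesgue_measure.-integrable `[a, b[ (EFin \o (fun t => f t * h t)).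
Proof.
move=> mf fM ch.
apply: measurable_bounded_integrable => //.
- by rewrite /= lebesgue_measure_itv /=; case: ifP => _; rewrite ?ltry.
- apply: measurable_funM => //; apply: measurable_funTS.
  exact: continuous_measurable_fun.
have [N hN] : exists N, forall t, a <= t <= b -> `|h t| <= N.
  apply: bounded_on_segment => p _; apply/cvg_ex; exists (h p).
    by apply: cvg_at_left_filter; exact: ch.
  by apply: cvg_at_right_filter; exact: ch.
exists (M * N); split; first exact: num_real.
move=> x MNx t /=; rewrite in_itv /= => /andP[at_ tb].
apply: le_trans (ltW MNx); rewrite normrM ler_pM//.
  by apply: fM; rewrite at_.
by apply: hN; rewrite at_ ltW.
Qed.

End JumpKernel.

(** * Integrals against the jump kernel recover one-sided limits *)

Section JumpLimit.
Variable R : realType.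
Set Implicit Arguments.
Unset Strict Implicit.
Implicit Types (f : R -> R) (e r s p a b c L M t : R).
Local Notation lambda := (@lebesgue_measure R).

Lemma jump_kernel_ge0 r s : 0 < r < 1 -> 0 <= s <= pi -> 0 <= jump_kernel r s.
Proof.
move=> r01 /sin_ge0_pi s0; have D0 := poisson_denom_gt0 s r01.
have /andP[r0 r1] := r01.
rewrite /jump_kernel divr_ge0 ?exprn_ge0// ?(ltW D0)//.
by rewrite !mulr_ge0// ?subr_ge0 ?exprn_ile1// ltW.
Qed.

(* [e = 1] and [e = -1] approach [p] from the right and from the left; the
   value of [f] at [p] is irrelevant since the kernel vanishes there. *)
Lemma jump_kernel_approx f e p a b c L M : e * e = 1 -> a < b -> c < 2 * pi ->
  (forall t, a <= t < b -> 0 <= e * (t - p) <= c) ->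
  measurable_fun `[a, b[ f -> (forall t, a <= t < b -> `|f t| <= M) ->
  (forall eps, 0 < eps -> exists2 d, 0 < d &
    forall t, a <= t < b -> 0 < e * (t - p) < d -> `|f t - L| <= eps) ->
  \int[lambda]_(t in `[a, b[) jump_kernel r (e * (t - p)) @[r --> (1 : R)^'-]
    --> (1 : R) ->
  \int[lambda]_(t in `[a, b[) (f t * jump_kernel r (e * (t - p)))
    @[r --> (1 : R)^'-] --> L.
Proof.
move=> ee1 ab c2pi etc mf fM fL K1.
pose g t := f t - L; pose N := `|M| + `|L| + 1.
have mg : measurable_fun `[a, b[ g by apply: measurable_funB.
have gN t : a <= t < b -> `|g t| <= N.
  move=> tab; rewrite /g /N (le_trans (ler_normB _ _))// -addrA lerD//.
    by rewrite (le_trans (fM t tab))// ler_norm.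
  by rewrite lerDl.
have N0 : 0 < N by rewrite /N ltr_wpDl// addr_ge0.
pose kern r t := jump_kernel r (e * (t - p)).
have ig r : 0 < r < 1 -> lambda.-integrable `[a, b[ (EFin \o (fun t => g t * kern r t)).
  by move=> r01; apply: (integrable_bounded_mul_continuous mg gN);
    exact: continuous_jump_kernel_affine.
have ik (k : R) r : 0 < r < 1 -> lambda.-integrable `[a, b[ (EFin \o (fun t => k * kern r t)).
  move=> r01; apply: (@integrable_bounded_mul_continuous _ (cst k) _ _ _ `|k|) => //.
  exact: continuous_jump_kernel_affine.
have ik1 r : 0 < r < 1 -> lambda.-integrable `[a, b[ (EFin \o kern r).
  move=> r01; have := ik 1 r r01; apply: eq_integrable => //.
  by move=> t _ /=; rewrite mul1r.
(* Since the integral of the kernel tends to [1], the constant [L] contributes exactly [L], and only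
   [g = f - L] remains. *)
suff g0 : \int[lambda]_(t in `[a, b[) (g t * kern r t) @[r --> (1 : R)^'-] --> (0 : R).
  have : \int[lambda]_(t in `[a, b[) (g t * kern r t) +
      L * \int[lambda]_(t in `[a, b[) kern r t @[r --> (1 : R)^'-] --> 0 + L * 1.
    by apply: cvgD => //; apply: cvgMr.
  rewrite add0r mulr1; apply: cvg_trans; apply: near_eq_cvg; near=> r.
  have r01 : 0 < r < 1.
    by apply/andP; split; near: r; [exact: nbhs_left_gt|exact: nbhs_left_lt].
  rewrite -RintegralZl ?ik1// -RintegralD//; [|exact: ig|exact: ik].
  by apply: eq_Rintegral => t _; rewrite /g /kern; ring.
apply/cvgrPdist_le => eps eps0.
pose eps1 := eps / 4.
have eps10 : 0 < eps1 by rewrite divr_gt0.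
have [d d0 fd] := fL _ eps10.
(* The cap at [pi] keeps the kernel nonnegative wherever [e * (t - p) < d1]. *)
pose d1 := Num.min d pi.
have d10 : 0 < d1 by rewrite lt_min d0 pi_gt0.
(* Away from [p] the product is at most [N * eta], and [eps1 * kern] may drop to [- eps1 * eta];
   hence the factor [N + eps1]. With this [eta] the constant [B] below integrates to [eps / 4]. *)
pose A := (N + eps1) * (b - a).
have A0 : 0 < A by rewrite mulr_gt0 ?subr_gt0// addr_gt0.
pose eta := eps / 4 / A.
have eta0 : 0 < eta by rewrite !divr_gt0.
near=> r; rewrite distrC subr0.
have r01 : 0 < r < 1.
  by apply/andP; split; near: r; [exact: nbhs_left_gt|exact: nbhs_left_lt].
have far s : d1 <= s <= c -> `|jump_kernel r s| <= eta.
  by move: s; near: r; exact: jump_kernel_far.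
(* The bound [2] on the integral of the kernel costs [eps / 2], so the total is at most
   [3 eps / 4]. *)
have K2 : \int[lambda]_(t in `[a, b[) kern r t <= 2.
  have : `|1 - \int[lambda]_(t in `[a, b[) kern r t| <= 1.
    near: r; by have /cvgrPdist_le/(_ _ ltr01) := K1.
  by rewrite ler_norml => /andP[? _]; lra.
pose B := (N + eps1) * eta.
(* The kernel is nonnegative near [p] and at least [- eta] elsewhere, so its
   integral, not its L1 norm, is enough to dominate. *)
have pointwise t : a <= t < b -> `|g t * kern r t| <= eps1 * kern r t + B.
  move=> tab; have /andP[et0 etc1] := etc t tab.
  have gt := gN t tab; rewrite normrM.
  have B0 : 0 <= B by rewrite mulr_ge0// ltW// addr_gt0.
  have [etd|det] := ltP (e * (t - p)) d1.
    have kge0 : 0 <= kern r t.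
      by apply: jump_kernel_ge0 => //; rewrite et0 (le_trans (ltW etd))// ge_min lexx orbT.
    rewrite [`|kern r t|]ger0_norm//.
    have [et00|et00] := eqVneq (e * (t - p)) 0.
      by rewrite /kern et00 /jump_kernel sin0 !(mulr0, mul0r) add0r.
    apply: (@le_trans _ _ (eps1 * kern r t)); last by rewrite lerDl.
    apply: ler_wpM2r => //; apply: fd => //.
    by rewrite lt_neqAle eq_sym et00 et0 /= (lt_le_trans etd)// ge_min lexx.
  have kfar : `|kern r t| <= eta by apply: far; rewrite det.
  apply: (@le_trans _ _ (N * eta)); first by apply: ler_pM.
  rewrite /B [X in _ <= _ + X]mulrDl addrCA lerDl -mulrDr mulr_ge0 ?(ltW eps10)//.
  by move: kfar; rewrite ler_norml => /andP[? _]; lra.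
apply: le_trans (le_normr_Rintegral _ (ig r r01)) _ => //.
have iB : lambda.-integrable `[a, b[ (EFin \o cst B).
  apply: measurable_bounded_integrable => //.
    by rewrite /= lebesgue_measure_itv /= lte_fin ab ltry.
  exists `|B|; split; first exact: num_real.
  by move=> x /ltW Bx t _.
apply: (@le_trans _ _ (\int[lambda]_(t in `[a, b[) (eps1 * kern r t + cst B t))).
  apply: le_Rintegral => //.
  - by have := integrable_norm (ig r r01).
  - by have := integrableD _ (ik eps1 r r01) iB => /(_ ltac:(by [])).
rewrite RintegralD//; last exact: ik.
rewrite RintegralZl ?ik1// Rintegral_cst//= lebesgue_measure_itv /= lte_fin ab /=.
have -> : B * (b - a) = eps / 4.
  rewrite /B /eta /A; field.
  by rewrite !gt_eqF// ?subr_gt0// addr_gt0.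
have : eps1 * \int[lambda]_(t in `[a, b[) kern r t <= eps1 * 2.
  by apply: ler_wpM2l => //; exact: ltW.
rewrite /eps1; lra.
Unshelve. all: by end_near. Qed.

(** Case [e = 1]: the kernel has integral [jump_primitive r (b - a) - jump_primitive r 0], which
    tends to [0 - (-1) = 1]. *)
Lemma jump_kernel_approx_right f a b L M : a < b < a + 2 * pi ->
  measurable_fun `[a, b[ f -> (forall t, a <= t < b -> `|f t| <= M) ->
  f t @[t --> a^'+] --> L ->
  \int[lambda]_(t in `[a, b[) (f t * jump_kernel r (t - a))
    @[r --> (1 : R)^'-] --> L.
Proof.
move=> /andP[ab b2pi] mf fM fL.
under eq_fun do under eq_Rintegral do rewrite -[_ - a]mul1r.
apply: (@jump_kernel_approx f 1 a a b (b - a) L M) => //.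
- by rewrite mulr1.
- by lra.
- by move=> t /andP[? ?]; apply/andP; split; lra.
- move=> eps eps0; have /cvgrPdist_le/(_ _ eps0)[d /= d0 fd] := fL.
  exists d => // t /andP[at_ tb] /andP[t0 td]; rewrite distrC; apply: fd => /=.
    by rewrite distrC ger0_norm; lra.
  lra.
have : 1 * jump_primitive r (1 * (b - a)) - 1 * jump_primitive r 0
    @[r --> (1 : R)^'-] --> 1 * (0 : R) - 1 * (-1).
  apply: cvgB; apply: cvgMr; last exact: jump_primitive0_cvg.
  by apply: jump_primitive_cvg0; apply: cos_lt1; apply/andP; split; lra.
rewrite mulr0 mulrN1 opprK add0r; apply: cvg_trans; apply: near_eq_cvg; near=> r.
have r01 : 0 < r < 1.
  by apply/andP; split; near: r; [exact: nbhs_left_gt|exact: nbhs_left_lt].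
by rewrite integral_jump_kernel ?mulr1// subrr mulr0.
Unshelve. all: by end_near. Qed.

(** The kernel is odd, so the case [e = -1] applies to [- f]; this is where the minus sign of the
    left limit in the jump comes from. *)
Lemma jump_kernel_approx_left f a b L M : a < b < a + 2 * pi ->
  measurable_fun `[a, b[ f -> (forall t, a <= t < b -> `|f t| <= M) ->
  f t @[t --> b^'-] --> L ->
  \int[lambda]_(t in `[a, b[) (f t * jump_kernel r (t - b))
    @[r --> (1 : R)^'-] --> - L.
Proof.
move=> /andP[ab b2pi] mf fM fL.
have -> : (fun r => \int[lambda]_(t in `[a, b[) (f t * jump_kernel r (t - b))) =
    (fun r => \int[lambda]_(t in `[a, b[) ((\- f) t * jump_kernel r (-1 * (t - b)))).
  apply/funext => r; apply: eq_Rintegral => t _.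
  by rewrite /jump_kernel /poisson_denom mulN1r cosN sinN /= mulrN !mulNr mulrN opprK.
apply: (@jump_kernel_approx (\- f) (-1) b a b (b - a) (- L) M) => //.
- by rewrite mulrNN mulr1.
- by lra.
- by move=> t /andP[? ?]; apply/andP; split; lra.
- exact: measurableT_comp.
- by move=> t tab; rewrite normrN fM.
- move=> eps eps0; have /cvgrPdist_le/(_ _ eps0)[d /= d0 fd] := fL.
  exists d => // t /andP[at_ tb] /andP[t0 td].
  rewrite opprK addrC; apply: fd => /=.
    by rewrite ger0_norm; lra.
  lra.
have : -1 * jump_primitive r 0 - -1 * jump_primitive r (b - a)
    @[r --> (1 : R)^'-] --> -1 * (-1 : R) - -1 * 0.
  apply: cvgB; apply: cvgMr; first exact: jump_primitive0_cvg.
  by apply: jump_primitive_cvg0; apply: cos_lt1; apply/andP; split; lra.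
rewrite mulr0 mulrNN mulr1 subr0; apply: cvg_trans; apply: near_eq_cvg; near=> r.
have r01 : 0 < r < 1.
  by apply/andP; split; near: r; [exact: nbhs_left_gt|exact: nbhs_left_lt].
by rewrite integral_jump_kernel ?mulrNN ?mulr1// subrr mulr0 !mulN1r opprB.
Unshelve. all: by end_near. Qed.

End JumpLimit.

(** * The real part of the Herglotz transform as a jump-kernel integral *)

Section HerglotzKernel.
Variable R : realType.
Set Implicit Arguments.
Unset Strict Implicit.
Implicit Types (r phi t M : R).

(** [X] and [Y] are the real and imaginary parts of [expi t - r expi phi]. *)
Let X r phi t := cos t - r * cos phi.
Let Y r phi t := sin t - r * sin phi.

(** Real part of [e^(it) / (e^(it) - z)^2] at [z = r e^(i phi)], obtained by multiplying above and
    below by the conjugate of [(X + iY)^2]. *)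
Definition herglotz_kernel_re r phi t :=
  (cos t * (X r phi t ^+ 2 - Y r phi t ^+ 2) + sin t * (2 * X r phi t * Y r phi t)) /
  poisson_denom r (t - phi) ^+ 2.

Definition herglotz_kernel_im r phi t :=
  (sin t * (X r phi t ^+ 2 - Y r phi t ^+ 2) - cos t * (2 * X r phi t * Y r phi t)) /
  poisson_denom r (t - phi) ^+ 2.

Lemma poisson_denom_sqr r phi t :
  poisson_denom r (t - phi) = X r phi t ^+ 2 + Y r phi t ^+ 2.
Proof.
rewrite /poisson_denom cosB /X /Y.
transitivity ((cos t ^+ 2 + sin t ^+ 2) - 2 * r * (cos t * cos phi + sin t * sin phi)
    + r ^+ 2 * (cos phi ^+ 2 + sin phi ^+ 2)); last by ring.
by rewrite !cos2Dsin2 mulr1.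
Qed.

Lemma herglotz_kernelE r phi t : 0 < r < 1 ->
  expi t / (expi t - r%:C * expi phi) ^+ 2 =
  herglotz_kernel_re r phi t +i* herglotz_kernel_im r phi t.
Proof.
move=> r01; have := poisson_denom_gt0 (t - phi) r01.
have -> : expi t - r%:C * expi phi = X r phi t +i* Y r phi t.
  by apply/eqP; rewrite eq_complex /= !mul0r subr0 addr0 /X /Y !eqxx.
rewrite /herglotz_kernel_re /herglotz_kernel_im poisson_denom_sqr.
set x := X r phi t; set y := Y r phi t => D0.
have w0 : (x +i* y) ^+ 2 != 0.
  rewrite expf_neq0//; apply: contraTneq D0 => -[-> ->].
  by rewrite expr0n addr0 ltxx.
apply: (mulIf w0); rewrite divfK// expr2.
apply/eqP; rewrite eq_complex /=; apply/andP; split; apply/eqP; field;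
  by rewrite gt_eqF.
Qed.

Let continuous_X r phi : continuous (X r phi).
Proof. by move=> t; apply: cvgB; [exact: continuous_cos|exact: cvg_cst]. Qed.

Let continuous_Y r phi : continuous (Y r phi).
Proof. by move=> t; apply: cvgB; [exact: continuous_sin|exact: cvg_cst]. Qed.

(** Covers both parts of the kernel: [h1, h2] are [cos, sin] for the real part and [sin, - cos] for
    the imaginary one. *)
Let continuous_herglotz_kernel (h1 h2 : R -> R) r phi : 0 < r < 1 ->
  continuous h1 -> continuous h2 -> continuous (fun t =>
    (h1 t * (X r phi t ^+ 2 - Y r phi t ^+ 2) + h2 t * (2 * X r phi t * Y r phi t)) /
    poisson_denom r (t - phi) ^+ 2).
Proof.
move=> r01 ch1 ch2 t; have cX := @continuous_X r phi t.
have cY := @continuous_Y r phi t.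
apply: cvgM.
  apply: cvgD; apply: cvgM; [exact: ch1| |exact: ch2|].
    by apply: cvgB; apply: cvgM.
  by apply: cvgM => //; apply: cvgMr.
apply: cvgV; first by rewrite expf_neq0// gt_eqF// poisson_denom_gt0.
have cD : {for t, continuous (fun t => poisson_denom r (t - phi))}.
  apply: (@continuous_comp _ _ _ (fun t => t - phi)).
    by apply: cvgB; [exact: cvg_id|exact: cvg_cst].
  exact: continuous_poisson_denom.
by apply: cvgM; exact: cD.
Qed.

Lemma continuous_herglotz_kernel_re r phi : 0 < r < 1 ->
  continuous (herglotz_kernel_re r phi).
Proof.
move=> r01; apply: continuous_herglotz_kernel => //.
  exact: continuous_cos.
exact: continuous_sin.
Qed.

Lemma continuous_herglotz_kernel_im r phi : 0 < r < 1 ->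
  continuous (herglotz_kernel_im r phi).
Proof.
move=> r01.
have cN : continuous (fun t => - cos t).
  by move=> t; apply: cvgN; exact: continuous_cos.
rewrite (_ : herglotz_kernel_im r phi = fun t =>
    (sin t * (X r phi t ^+ 2 - Y r phi t ^+ 2) + - cos t * (2 * X r phi t * Y r phi t)) /
    poisson_denom r (t - phi) ^+ 2).
  by apply: continuous_herglotz_kernel => //; exact: continuous_sin.
by apply/funext => t; rewrite mulNr.
Qed.

(** The left side is [(1 - r) / 2] times the real part of [2 i z e^(it) / (e^(it) - z)^2] at
    [z = r e^(i phi)]. Its numerator contains [sin (t - phi)] times [(cos^2 t + sin^2 t) - r^2
    (cos^2 phi + sin^2 phi)], that is, [1 - r^2]. *)
Lemma jump_kernel_herglotz r phi t :
  (1 - r) * r * (- sin phi * herglotz_kernel_re r phi t -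
    cos phi * herglotz_kernel_im r phi t) = jump_kernel r (t - phi).
Proof.
rewrite /jump_kernel /herglotz_kernel_re /herglotz_kernel_im.
set D := (poisson_denom _ _ ^+ 2)^-1.
transitivity (r * (1 - r) * ((cos t ^+ 2 + sin t ^+ 2) -
    r ^+ 2 * (cos phi ^+ 2 + sin phi ^+ 2)) *
    (sin t * cos phi - cos t * sin phi) * D).
  by rewrite /X /Y; ring.
by rewrite !cos2Dsin2 mulr1 -sinB.
Qed.

Lemma Re_herglotz (mu : set R[i] -> R) r phi M : 0 < r < 1 ->
  measurable_fun `[0, 2 * pi[ (cumulative_mass mu) ->
  (forall t, 0 <= t < 2 * pi -> `|cumulative_mass mu t| <= M) ->
  2^-1 * (1 - r) * complex.Re (herglotz mu (r%:C * expi phi)) =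
  \int[lebesgue_measure]_(t in `[0, 2 * pi[)
    (cumulative_mass mu t * jump_kernel r (t - phi)).
Proof.
move=> r01 mF FM; set F := cumulative_mass mu in mF FM *.
pose u := herglotz_kernel_re r phi; pose v := herglotz_kernel_im r phi.
have int_mul (h : R -> R) (k : R) : continuous h -> lebesgue_measure.-integrable
    `[0, 2 * pi[ (EFin \o (fun t => k * (F t * h t))).
  move=> ch; have : continuous (fun t => k * h t).
    by move=> t; apply: cvgMr; exact: ch.
  move/(integrable_bounded_mul_continuous mF FM); apply: eq_integrable => //.
  by move=> t _ /=; rewrite mulrCA.
have iFu : lebesgue_measure.-integrable `[0, 2 * pi[ (EFin \o (fun t => F t * u t)).
  exact: (integrable_bounded_mul_continuous mF FM (@continuous_herglotz_kernel_re _ _ r01)).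
have iFv : lebesgue_measure.-integrable `[0, 2 * pi[ (EFin \o (fun t => F t * v t)).
  exact: (integrable_bounded_mul_continuous mF FM (@continuous_herglotz_kernel_im _ _ r01)).
rewrite /herglotz /Cintegral.
pose U := \int[lebesgue_measure]_(t in `[0, 2 * pi[) (F t * u t).
pose V := \int[lebesgue_measure]_(t in `[0, 2 * pi[) (F t * v t).
have -> : \int[lebesgue_measure]_(t in `[0, 2 * pi[) complex.Re (expi t /
    (expi t - r%:C * expi phi) ^+ 2 * (F t)%:C) = U.
  by apply: eq_Rintegral => t _; rewrite herglotz_kernelE//= mulr0 subr0 mulrC.
have -> : \int[lebesgue_measure]_(t in `[0, 2 * pi[) complex.Im (expi t /
    (expi t - r%:C * expi phi) ^+ 2 * (F t)%:C) = V.
  by apply: eq_Rintegral => t _; rewrite herglotz_kernelE//= mulr0 add0r mulrC.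
(* This is the real part of [2 i r e^(i phi) (U + iV)], scaled by [(1 - r) / 2]. *)
transitivity (- ((1 - r) * r * sin phi) * U - (1 - r) * r * cos phi * V).
  by rewrite /=; field.
rewrite -!RintegralZl// -RintegralB//.
- apply: eq_Rintegral => t _; rewrite -jump_kernel_herglotz /u /v; ring.
- by apply: int_mul; exact: continuous_herglotz_kernel_re.
- by apply: int_mul; exact: continuous_herglotz_kernel_im.
Qed.

End HerglotzKernel.

(** * The radial limit *)

Theorem theorem25 (R : realType) (mu : set R[i] -> R) (eta : R[i])
    (mu_premeasure : is_premeasure mu) (eta_circle : circle eta) :
  2^-1 * (1 - r) * complex.Re (herglotz mu (r%:C * eta)) @[r --> (1 : R)^'-]
    --> mu [set eta].
Proof.
have [phi /andP[phi0 phi2pi] <-] := circle_expi _ _ eta_circle.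
have pi0 := pi_gt0 R.
pose F := cumulative_mass mu.
(* Measurability on [[0, 2 pi[] asks for left continuity at [0] too, where it comes from the value
   [0] of [F] at nonpositive angles. *)
have Fl p : p <= 2 * pi -> F t @[t --> p^'-] --> F p.
  move=> p2pi; have [p0|p0] := ltP 0 p.
    by apply: cumulative_mass_cvg_left => //; rewrite p0.
  rewrite /F [X in _ --> X]cumulative_mass_le0//.
  apply: (@cvg_trans _ (cst 0 t @[t --> p^'-])); last exact: cvg_cst.
  apply: near_eq_cvg; near=> t; rewrite cumulative_mass_le0//.
  by apply/ltW/(lt_le_trans _ p0); near: t; exact: nbhs_left_lt.
have Fr p : 0 <= p < 2 * pi -> F t @[t --> p^'+] --> F p + mu [set expi p].
  exact: cumulative_mass_cvg_right.
have mF : measurable_fun `[0, 2 * pi[ F.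
  apply: left_continuous_measurable_fun => t /=; rewrite in_itv /= => /andP[_ /ltW].
  exact: Fl.
have [M FM] : exists M, forall t, 0 <= t <= 2 * pi -> `|F t| <= M.
  apply: bounded_on_segment => p pb; apply/cvg_ex.
    by exists (F p); apply: Fl; case/andP: pb.
  by exists (F p + mu [set expi p]); exact: Fr.
have FM' t : 0 <= t < 2 * pi -> `|F t| <= M.
  by move=> /andP[t0 t2pi]; apply: FM; rewrite t0 ltW.
have mFsub a b : 0 <= a -> b <= 2 * pi -> measurable_fun `[a, b[ F.
  move=> a0 b2pi; apply: measurable_funS mF => //.
  by apply: subset_itv; rewrite bnd_simp.
have FMsub a b : 0 <= a -> b <= 2 * pi -> forall t, a <= t < b -> `|F t| <= M.
  by move=> a0 b2pi t /andP[at_ tb]; apply: FM; apply/andP; split; lra.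
(* The cut [c] is chosen so that the jump sits at an endpoint of each piece, as the one-sided lemmas
   require. *)
have splitF c (r : R) : 0 < r < 1 -> 0 <= c <= 2 * pi ->
    2^-1 * (1 - r) * complex.Re (herglotz mu (r%:C * expi phi)) =
    \int[lebesgue_measure]_(t in `[0, c[) (F t * jump_kernel r (t - phi)) +
    \int[lebesgue_measure]_(t in `[c, 2 * pi[) (F t * jump_kernel r (t - phi)).
  move=> r01 /andP[c0 c2pi]; rewrite (Re_herglotz phi r01 mF FM').
  have E : `[0, 2 * pi[%classic = `[0, c[ `|` `[c, 2 * pi[.
    by apply: itv_bndbnd_setU; rewrite bnd_simp.
  rewrite E Rintegral_setU//.
    rewrite -E; apply: (integrable_bounded_mul_continuous mF FM').
    move=> t; apply: (@continuous_comp _ _ _ (fun t => t - phi)).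
      by apply: cvgB; [exact: cvg_id|exact: cvg_cst].
    exact: continuous_jump_kernel.
  apply/disj_setPRL => x /=; rewrite !in_itv /= => /andP[cx _] /andP[_].
  by rewrite ltNge cx.
have := phi0; rewrite le_eqVlt => /predU1P[phiE|phi_gt0].
  (* The cut at [pi] makes [0] the left end of one piece and [2 * pi] the right end of the other,
     both shorter than a full turn; periodicity of the kernel lets [t - 2 * pi] replace [t]. *)
  have : \int[lebesgue_measure]_(t in `[0, pi[) (F t * jump_kernel r (t - 0)) +
      \int[lebesgue_measure]_(t in `[pi, 2 * pi[) (F t * jump_kernel r (t - 2 * pi))
      @[r --> (1 : R)^'-] --> (F 0 + mu [set expi 0]) + - F (2 * pi).
    apply: cvgD.
      apply: (@jump_kernel_approx_right _ _ _ _ _ M); first by apply/andP; split; lra.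
      + by apply: mFsub => //; lra.
      + by apply: FMsub => //; lra.
      + by apply: Fr; apply/andP; split; lra.
    apply: (@jump_kernel_approx_left _ _ _ _ _ M); first by apply/andP; split; lra.
    + by apply: mFsub => //; lra.
    + by apply: FMsub => //; lra.
    + exact: Fl.
  rewrite /F cumulative_mass_le0// cumulative_mass_2pi// add0r subr0 -phiE.
  apply: cvg_trans; apply: near_eq_cvg; near=> r.
  have r01 : 0 < r < 1.
    by apply/andP; split; near: r; [exact: nbhs_left_gt|exact: nbhs_left_lt].
  rewrite phiE (splitF pi)//; last by apply/andP; split; lra.
  rewrite -phiE; congr (_ + _); apply: eq_Rintegral => t _; congr (_ * _).
  have tE : t - 0 = t - 2 * pi + pi *+ 2 by rewrite mulr2n; lra.
  by rewrite /jump_kernel /poisson_denom tE sinD2pi cosD2pi.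
(* Cut at [phi] itself: the two copies of [F phi] cancel and the point mass remains. *)
have : \int[lebesgue_measure]_(t in `[0, phi[) (F t * jump_kernel r (t - phi)) +
    \int[lebesgue_measure]_(t in `[phi, 2 * pi[) (F t * jump_kernel r (t - phi))
    @[r --> (1 : R)^'-] --> - F phi + (F phi + mu [set expi phi]).
  apply: cvgD.
    apply: (@jump_kernel_approx_left _ _ _ _ _ M); first by apply/andP; split; lra.
    + by apply: mFsub => //; lra.
    + by apply: FMsub => //; lra.
    + by apply: Fl; lra.
  apply: (@jump_kernel_approx_right _ _ _ _ _ M); first by apply/andP; split; lra.
  + exact: mFsub.
  + exact: FMsub.
  + by apply: Fr; rewrite phi0.
rewrite addKr; apply: cvg_trans; apply: near_eq_cvg; near=> r.
have r01 : 0 < r < 1.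
  by apply/andP; split; near: r; [exact: nbhs_left_gt|exact: nbhs_left_lt].
by rewrite (splitF phi)//; rewrite phi0 ltW.
Unshelve. all: by end_near. Qed.
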